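(* Let $\chi=(P,Q,R)$ be a cubic Kolmogorov vector field in $\mathbb{R}^3$. Then $\chi$ is a vector field on $\mathbb{T}^2$ if and only if there exist $c_1,c_2\in\mathbb{R}$ such that $$P=\tfrac14 Kx+c_1xy^2,\qquad Q=\tfrac14 Ky-c_1x^2y,\qquad R=\tfrac{c_2}{2}z\big(-a^2(x^2+y^2)+z^2+a^4-1\big),$$ where $K=c_2z^2$ is the cofactor of $\chi$ for $\mathbb{T}^2$.
   Context: Fix a real number $a>1$ and let $\mathbb{T}^2=\{(x,y,z)\in\mathbb{R}^3:(x^2+y^2-a^2)^2+z^2-1=0\}$. A triple $\chi=(P,Q,R)$ with $P,Q,R\in\mathbb{R}[x,y,z]$ denotes the polynomial vector field $P\frac{\partial}{\partial x}+Q\frac{\partial}{\partial y}+R\frac{\partial}{\partial z}$ in $\mathbb{R}^3$, acting on polynomials as a derivation; its degree is $\max\{\deg P,\deg Q,\deg R\}$, and it is cubic if its degree is $3$. It is a Kolmogorov vector field if $x\mid P$, $y\mid Q$, $z\mid R$. It is called a vector field on $\mathbb{T}^2$ if $\chi F=KF$ for some $K\in\mathbb{R}[x,y,z]$, where $F=(x^2+y^2-a^2)^2+z^2-1$; the polynomial $K$ is then called the cofactor of $\chi$ for $\mathbb{T}^2$. *)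

(* Defs.v *)
From HB Require Import structures.
From mathcomp Require Import all_boot all_order all_algebra.
From mathcomp Require Import reals.
From mathcomp Require Import mpoly.

Set Implicit Arguments.
Unset Strict Implicit.
Unset Printing Implicit Defensive.

Import Order.TTheory GRing.Theory Num.Theory.
Local Open Scope ring_scope.

Definition varx (R : realType) : {mpoly R[3]} := 'X_(inord 0).
Definition vary (R : realType) : {mpoly R[3]} := 'X_(inord 1).
Definition varz (R : realType) : {mpoly R[3]} := 'X_(inord 2).
Arguments varx {R}.
Arguments vary {R}.
Arguments varz {R}.

Record polyvf (R : realType) := PolyVF {
  vfP : {mpoly R[3]};
  vfQ : {mpoly R[3]};
  vfR : {mpoly R[3]} }.

Definition vf_act (R : realType) (chi : polyvf R) (f : {mpoly R[3]}) :
    {mpoly R[3]} :=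
  vfP chi * f^`M(inord 0) + vfQ chi * f^`M(inord 1) + vfR chi * f^`M(inord 2).

(* [msize p] is the total degree plus one for p != 0, and 0 for p = 0, so the
   zero polynomial is given degree 0 here. *)
Definition mpdeg (R : realType) (p : {mpoly R[3]}) : nat := (msize p).-1.

Definition vf_deg (R : realType) (chi : polyvf R) : nat :=
  maxn (mpdeg (vfP chi)) (maxn (mpdeg (vfQ chi)) (mpdeg (vfR chi))).

Definition cubic (R : realType) (chi : polyvf R) : Prop := vf_deg chi = 3%N.

Definition mpdvd (R : realType) (d p : {mpoly R[3]}) : Prop :=
  exists q : {mpoly R[3]}, p = d * q.

Definition kolmogorov (R : realType) (chi : polyvf R) : Prop :=
  [/\ mpdvd varx (vfP chi), mpdvd vary (vfQ chi) & mpdvd varz (vfR chi)].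

Definition torus_poly (R : realType) (a : R) : {mpoly R[3]} :=
  (varx ^+ 2 + vary ^+ 2 - (a ^+ 2)%:MP) ^+ 2 + varz ^+ 2 - 1.

Definition is_cofactor (R : realType) (a : R) (chi : polyvf R)
    (K : {mpoly R[3]}) : Prop :=
  vf_act chi (torus_poly a) = K * torus_poly a.

Definition vf_on_torus (R : realType) (a : R) (chi : polyvf R) : Prop :=
  exists K : {mpoly R[3]}, is_cofactor a chi K.

Definition torus_form (R : realType) (a c1 c2 : R) (chi : polyvf R) : Prop :=
  let K := c2 *: varz ^+ 2 in
  [/\ vfP chi = (1 / 4) *: (K * varx) + c1 *: (varx * vary ^+ 2),
      vfQ chi = (1 / 4) *: (K * vary) - c1 *: (varx ^+ 2 * vary) &
      vfR chi = (c2 / 2) *: (varz * (- (a ^+ 2 *: (varx ^+ 2 + vary ^+ 2))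
                                     + varz ^+ 2 + (a ^+ 4 - 1)%:MP))].

(* Main.v *)
(* Write P = x p, Q = y q, R = z r and u = x^2 + y^2 - a^2. Then K is a cofactor
   iff 4 u (x^2 p + y^2 q) + 2 z^2 r = K (u^2 + z^2 - 1), where p, q, r and,
   comparing degrees, K are at most quadratic. Compare the coefficients of z^i.
   For i = 0 and i = 1 the identity reads 4 u (x^2 A + y^2 B) = C (u^2 - 1): C
   vanishes on the circle u = 0, hence C = c u, and evaluating at the origin gives
   c (a^4 - 1) = 0, so C = 0 because a > 1; then x^2 A + y^2 B = 0 forces
   A = c1 y^2 and B = - c1 x^2. Hence K = c2 z^2, and the coefficients of z^2,
   z^3 and z^4 determine the rest of p, q and r. *)

Require Import Defs.
From mathcomp Require Import all_boot all_order all_algebra.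
From mathcomp Require Import reals.
From mathcomp Require Import mpoly.
From mathcomp Require Import ring lra zify.
Import Order.TTheory GRing.Theory Num.Theory.
Local Open Scope ring_scope.

(** * Identities between real quadratic polynomials *)

Definition quad2 {T : pzRingType} (k : nat -> T) (x y : T) : T :=
  k 0%N + k 1%N * x + k 2%N * y
  + k 3%N * x ^+ 2 + k 4%N * x * y + k 5%N * y ^+ 2.

(** Both forms live over any ring, so that the same coefficients give real values and, composed with
    [mpolyC], polynomials. *)
Definition quad3 {T : pzRingType} (k : nat -> T) (x y z : T) : T :=
  quad2 k x y + (k 6%N + k 7%N * x + k 8%N * y) * z + k 9%N * z ^+ 2.

(** The values at 0, 1, -1, 2 and -2 form an invertible Vandermonde system. *)
Lemma quartic_coef0 (R : realFieldType) (e0 e1 e2 e3 e4 : R) :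
  (forall t : R, e0 + e1 * t + e2 * t ^+ 2 + e3 * t ^+ 3 + e4 * t ^+ 4 = 0) ->
  [/\ e0 = 0, e1 = 0, e2 = 0, e3 = 0 & e4 = 0].
Proof.
move=> h; move: (h 0) (h 1) (h (-1)) (h 2) (h (-2)) => h0 h1 h2 h3 h4.
by split; lra.
Qed.

(** Serves for the coefficients of both z^0 and z^1. The surviving parameter p5 = - q3 yields the
    rotation field multiplied by c1 xy. *)
Lemma quad2_section (R : realFieldType) (a : R) (p q k : nat -> R) :
  1 < a ->
  (forall x y, 4 * (x ^+ 2 + y ^+ 2 - a ^+ 2)
                 * (x ^+ 2 * quad2 p x y + y ^+ 2 * quad2 q x y)
               = quad2 k x y * ((x ^+ 2 + y ^+ 2 - a ^+ 2) ^+ 2 - 1)) ->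
  [/\ [/\ k 0%N = 0, k 1%N = 0, k 2%N = 0 & [/\ k 3%N = 0, k 4%N = 0 & k 5%N = 0]],
      [/\ p 0%N = 0, p 1%N = 0, p 2%N = 0, p 3%N = 0 & p 4%N = 0],
      [/\ q 0%N = 0, q 1%N = 0, q 2%N = 0, q 4%N = 0 & q 5%N = 0] &
      q 3%N = - p 5%N].
Proof.
move=> a1 h.
have a0 : a != 0 by lra.
have a21 : 1 < a ^+ 2 by nra.
have hk0 : k 0%N = 0.
  have := h 0 0; rewrite /quad2 => E.
  have /eqP : k 0%N * ((a ^+ 2 - 1) * (a ^+ 2 + 1)) = 0 by lra.
  by rewrite mulf_eq0 => /orP[/eqP // | /eqP]; nra.
have hcirc c s : c ^+ 2 + s ^+ 2 = 1 -> quad2 k (c * a) (s * a) = 0.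
  move=> cs; have := h (c * a) (s * a).
  rewrite !exprMn -mulrDl cs; lra.
(* A conic through these five points of the circle is a multiple of u, and k 0 = 0
   then makes it vanish. *)
have [h1 h2 h3 h4 h5] :
    [/\ k 1%N * a = 0, k 2%N * a = 0, k 3%N * a ^+ 2 = 0, k 4%N * a ^+ 2 = 0 &
        k 5%N * a ^+ 2 = 0].
  have := hcirc 1 0; have := hcirc (-1) 0; have := hcirc 0 1.
  have := hcirc 0 (-1); have := hcirc (3 / 5) (4 / 5).
  rewrite /quad2 hk0 => e1 e2 e3 e4 e5.
  have {}e1 := e1 ltac:(lra). have {}e2 := e2 ltac:(lra).
  have {}e3 := e3 ltac:(lra). have {}e4 := e4 ltac:(lra).
  have {}e5 := e5 ltac:(lra).
  by split; lra.
have cancel n (c : R) : c * a ^+ n = 0 -> c = 0.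
  by move/eqP; rewrite mulf_eq0 expf_eq0 (negbTE a0) andbF orbF => /eqP.
have k1 := cancel 1%N _ h1; have k2 := cancel 1%N _ h2.
have k3 := cancel 2%N _ h3; have k4 := cancel 2%N _ h4.
have k5 := cancel 2%N _ h5.
(* On the unit disc u < 0 since a > 1, so u can be cancelled there. *)
have g x y : x ^+ 2 + y ^+ 2 <= 1 ->
    x ^+ 2 * quad2 p x y + y ^+ 2 * quad2 q x y = 0.
  move=> xy; have := h x y; rewrite {3}/quad2 hk0 k1 k2 k3 k4 k5 !mul0r !addr0 mul0r.
  move/eqP; rewrite -mulrA mulf_eq0 => /orP[|]; first by lra.
  by rewrite mulf_eq0 => /orP[|/eqP //]; lra.
(* On the x-axis the identity is x^2 (p0 + p1 x + p3 x^2) = 0, so three nonzero abscissae suffice;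
   the y-axis does the same for [q]. *)
have gx := g (1 / 2) 0 ltac:(clear; lra).
have gx' := g (-1 / 2) 0 ltac:(clear; lra).
have gx'' := g (1 / 4) 0 ltac:(clear; lra).
have gy := g 0 (1 / 2) ltac:(clear; lra).
have gy' := g 0 (-1 / 2) ltac:(clear; lra).
have gy'' := g 0 (1 / 4) ltac:(clear; lra).
rewrite /quad2 in gx gx' gx'' gy gy' gy''.
have [p0 p1 p3] : [/\ p 0%N = 0, p 1%N = 0 & p 3%N = 0] by split; lra.
have [q0 q2 q5] : [/\ q 0%N = 0, q 2%N = 0 & q 5%N = 0] by split; lra.
rewrite /quad2 p0 p1 p3 q0 q2 q5 in g.
(* Off the axes, dividing by xy leaves p2 x + q1 y + p4 x^2 + (p5 + q3) xy + q4 y^2, whose five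
   coefficients must vanish. *)
have g1 := g (1 / 2) (1 / 2) ltac:(clear; lra).
have g2 := g (1 / 2) (-1 / 2) ltac:(clear; lra).
have g3 := g (-1 / 2) (1 / 2) ltac:(clear; lra).
have g4 := g (1 / 2) (1 / 4) ltac:(clear; lra).
have g5 := g (1 / 2) (-1 / 4) ltac:(clear; lra).
have g6 := g (-1 / 2) (1 / 4) ltac:(clear; lra).
clear - hk0 k1 k2 k3 k4 k5 p0 p1 p3 q0 q2 q5 g1 g2 g3 g4 g5 g6.
have [p2 p4 q1] : [/\ p 2%N = 0, p 4%N = 0 & q 1%N = 0] by split; lra.
by have [q4 q3] : q 4%N = 0 /\ q 3%N = - p 5%N by split; lra.
Qed.

(** Real values determine the coefficients; the resulting closed forms then hold in any commutative
    ring that receives [R], and are used with [f] the embedding of constants into polynomials. *)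
Lemma quad3_torus (R : realFieldType) (a : R) (p q r k : nat -> R) :
  1 < a ->
  (forall x y z,
     4 * (x ^+ 2 + y ^+ 2 - a ^+ 2)
       * (x ^+ 2 * quad3 p x y z + y ^+ 2 * quad3 q x y z)
     + 2 * z ^+ 2 * quad3 r x y z
     = quad3 k x y z * ((x ^+ 2 + y ^+ 2 - a ^+ 2) ^+ 2 + z ^+ 2 - 1)) ->
  let c1 := p 5%N in let c2 := k 9%N in
  forall (T : comPzRingType) (f : {rmorphism R -> T}) (x y z : T),
  [/\ quad3 (f \o p) x y z = f (1 / 4) * (f c2 * z ^+ 2) + f c1 * y ^+ 2,
      quad3 (f \o q) x y z = f (1 / 4) * (f c2 * z ^+ 2) - f c1 * x ^+ 2 &
      quad3 (f \o r) x y z =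
        f (c2 / 2) * (- (f a ^+ 2 * (x ^+ 2 + y ^+ 2)) + z ^+ 2 + (f a ^+ 4 - 1))].
Proof.
move=> a1 h c1 c2.
(* The coefficient of z as a conic: the default 0 of [nth] kills its quadratic part. *)
pose lin (c : nat -> R) i : R := nth 0 [:: c 6%N; c 7%N; c 8%N] i.
(* For fixed x and y the difference of the two sides is a quartic in z, with these coefficients. *)
have slices x y := quartic_coef0 R
  (4 * (x ^+ 2 + y ^+ 2 - a ^+ 2) * (x ^+ 2 * quad2 p x y + y ^+ 2 * quad2 q x y)
     - quad2 k x y * ((x ^+ 2 + y ^+ 2 - a ^+ 2) ^+ 2 - 1))
  (4 * (x ^+ 2 + y ^+ 2 - a ^+ 2)
       * (x ^+ 2 * quad2 (lin p) x y + y ^+ 2 * quad2 (lin q) x y)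
     - quad2 (lin k) x y * ((x ^+ 2 + y ^+ 2 - a ^+ 2) ^+ 2 - 1))
  (4 * (x ^+ 2 + y ^+ 2 - a ^+ 2) * (x ^+ 2 * p 9%N + y ^+ 2 * q 9%N)
     + 2 * quad2 r x y - k 9%N * ((x ^+ 2 + y ^+ 2 - a ^+ 2) ^+ 2 - 1)
     - quad2 k x y)
  (2 * quad2 (lin r) x y - quad2 (lin k) x y)
  (2 * r 9%N - k 9%N).
have {}slices x y := slices x y ltac:(by
  move=> t; have := h x y t; rewrite /quad3 /quad2 /lin /= => E; lra).
have := quad2_section R a p q k a1.
case=> [x y|[k0 k1 k2 [k3 k4 k5]] [p0 p1 p2 p3 p4] [q0 q1 q2 q4 q5] q3].
  by have [e _ _ _ _] := slices x y; apply: subr0_eq.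
have := quad2_section R a (lin p) (lin q) (lin k) a1.
case=> [x y|[k6 k7 k8 _] [p6 p7 p8 _ _] [q6 q7 q8 _ _] _].
  by have [_ e _ _ _] := slices x y; apply: subr0_eq.
rewrite /lin /= in k6 k7 k8 p6 p7 p8 q6 q7 q8.
have {}slices x y : [/\ 4 * (x ^+ 2 + y ^+ 2 - a ^+ 2) * (x ^+ 2 * p 9%N + y ^+ 2 * q 9%N)
     + 2 * quad2 r x y = k 9%N * ((x ^+ 2 + y ^+ 2 - a ^+ 2) ^+ 2 - 1),
    r 6%N + r 7%N * x + r 8%N * y = 0 & 2 * r 9%N = k 9%N].
  case: (slices x y) => _ _; rewrite /quad2 /lin /=.
  rewrite k0 k1 k2 k3 k4 k5 k6 k7 k8 => e2 e3 e4.
  by split; lra.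
have [r6 r7 r8] : [/\ r 6%N = 0, r 7%N = 0 & r 8%N = 0].
  have [_ e0 _] := slices 0 0; have [_ e1 _] := slices 1 0.
  have [_ e2 _] := slices 0 1; split; lra.
have r9 : r 9%N = c2 / 2 by have [_ _] := slices 0 0; rewrite /c2; lra.
(* Restricted to an axis, the z^2 identity is a quartic in one variable: its leading coefficient
   gives p9 (or q9), the lower ones give [r]. *)
have [rx0 rx1 rx2 _ rx4] := quartic_coef0 R
  (2 * r 0%N - c2 * (a ^+ 4 - 1)) (2 * r 1%N)
  (2 * r 3%N - 4 * a ^+ 2 * p 9%N + 2 * c2 * a ^+ 2) 0 (4 * p 9%N - c2)
  ltac:(by move=> t; have [] := slices t 0; rewrite /quad2 /c2; lra).
have [_ ry1 ry2 _ ry4] := quartic_coef0 R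
  (2 * r 0%N - c2 * (a ^+ 4 - 1)) (2 * r 2%N)
  (2 * r 5%N - 4 * a ^+ 2 * q 9%N + 2 * c2 * a ^+ 2) 0 (4 * q 9%N - c2)
  ltac:(by move=> t; have [] := slices 0 t; rewrite /quad2 /c2; lra).
have p9 : p 9%N = c2 / 4 by lra.
have q9 : q 9%N = c2 / 4 by lra.
have r0 : r 0%N = c2 / 2 * (a ^+ 4 - 1) by lra.
have r1 : r 1%N = 0 by lra.
have r2 : r 2%N = 0 by lra.
have r3 : r 3%N = - (c2 / 2 * a ^+ 2) by rewrite p9 in rx2; lra.
have r5 : r 5%N = - (c2 / 2 * a ^+ 2) by rewrite q9 in ry2; lra.
(* The xy coefficient is invisible on the axes, hence the point (1, 1). *)
have r4 : r 4%N = 0.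
  have [e _ _] := slices 1 1; move: e; rewrite /quad2 p9 q9 r0 r1 r2 r3 r5 -/c2; lra.
move=> T f x y z; rewrite /quad3 /quad2 /= -/c1.
rewrite p0 p1 p2 p3 p4 p6 p7 p8 p9 q0 q1 q2 q3 q4 q5 q6 q7 q8 q9.
rewrite r0 r1 r2 r3 r4 r5 r6 r7 r8 r9 -/c1.
rewrite !(rmorph0, rmorphN, rmorphM, rmorphB, rmorphXn, rmorph1).
by split; ring.
Qed.

(** * Coefficients of polynomials of degree at most two *)

Lemma mpoly_split (n : nat) (R : comNzRingType) (d : nat) (p : {mpoly R[n]}) :
  (msize p <= d.+1)%N ->
  exists (c : R) (A : 'I_n -> {mpoly R[n]}),
    (forall i, (msize (A i) <= d)%N) /\ p = c%:MP + \sum_i 'X_i * A i.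
Proof.
move=> hp; rewrite [p]mpolyE big_seq.
elim/big_ind: _ => [|_ _ [c [A [hA ->]]] [e [B [hB ->]]]|m hm].
- exists 0, (fun _ => 0); split=> [i|]; first by rewrite mmeasure0.
  by rewrite big1 ?addr0 // => i _; rewrite mulr0.
- exists (c + e), (fun i => A i + B i); split=> [i|].
    by rewrite (leq_trans (mmeasureD_le _ _ _)) // geq_max hA hB.
  rewrite mpolyCD addrACA -big_split; congr (_ + _).
  by apply: eq_bigr => i _; rewrite mulrDr.
have {hp}hm : (mdeg m <= d)%N by have := msize_mdeg_lt hm; lia.
have [->|m0] := eqVneq m 0%MM.
  exists p@_0, (fun _ => 0); split=> [i|]; first by rewrite mmeasure0.
  by rewrite mpolyX0 alg_mpolyC big1 ?addr0 // => i _; rewrite mulr0.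
(* A nonconstant monomial is charged entirely to one variable dividing it. *)
have [i hi] : exists i, (0 < m i)%N.
  apply/existsP; rewrite -[[exists _, _]]negbK negb_exists; apply/negP=> /forallP h.
  case/eqP: m0; apply/mnmP=> i; have := h i; rewrite mnm0E -leqNgt; lia.
have Um : (U_(i) <= m)%MM.
  by apply/mnm_lepP=> j; rewrite mnm1E; case: eqP => [<-|].
exists 0, (fun j => if j == i then p@_m *: 'X_[m - U_(i)] else 0); split=> [j|].
  case: ifP => _; last by rewrite mmeasure0.
  rewrite (leq_trans (msizeZ_le _ _)) // msizeX.
  by move: hm; rewrite -{1}(submK Um) mdegD mdeg1 addn1.
rewrite mpolyC0 add0r (bigD1 i) //= eqxx big1 ?addr0 => [|j /negbTE ->];
  last by rewrite mulr0.
by rewrite -scalerAr -mpolyXD addmC submK.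
Qed.

Lemma mpoly3_split (R : realType) (d : nat) (p : {mpoly R[3]}) :
  (msize p <= d.+1)%N ->
  exists (c : R) (A B C : {mpoly R[3]}),
    [/\ (msize A <= d)%N, (msize B <= d)%N, (msize C <= d)%N &
        p = c%:MP + varx * A + vary * B + varz * C].
Proof.
move=> /mpoly_split[c [A [hA ->]]].
exists c, (A (inord 0)), (A (inord 1)), (A (inord 2)); split=> //.
rewrite !big_ord_recl big_ord0 addr0 !addrA /varx /vary /varz.
by congr (_ + 'X_(_) * A _ + 'X_(_) * A _ + 'X_(_) * A _);
  apply/val_inj; rewrite /= ?inordK.
Qed.

Lemma msize3_quad3 (R : realType) (p : {mpoly R[3]}) : (msize p <= 3)%N ->
  exists k : nat -> R, p = quad3 (@mpolyC 3 R \o k) varx vary varz.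
Proof.
move=> /mpoly3_split[c [A [B [C [hA hB hC ->]]]]].
have [a [A1 [A2 [A3 [/msize1_polyC -> /msize1_polyC -> /msize1_polyC -> ->]]]]] :=
  mpoly3_split _ _ _ hA.
have [b [B1 [B2 [B3 [/msize1_polyC -> /msize1_polyC -> /msize1_polyC -> ->]]]]] :=
  mpoly3_split _ _ _ hB.
have [e [C1 [C2 [C3 [/msize1_polyC -> /msize1_polyC -> /msize1_polyC -> ->]]]]] :=
  mpoly3_split _ _ _ hC.
(* The splitting is not unique, so each mixed monomial gathers two constants, such as those of [A2]
   and [B1] for xy. *)
exists (nth 0 [:: c; a; b; A1@_0; A2@_0 + B1@_0; B2@_0;
               e; A3@_0 + C1@_0; B3@_0 + C2@_0; C3@_0]).
rewrite /quad3 /quad2 /= !mpolyCD; ring.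
Qed.

Lemma quad3_meval (R : realType) (k : nat -> R) (v : 'I_3 -> R) :
  (quad3 (@mpolyC 3 R \o k) varx vary varz).@[v]
  = quad3 k (v (inord 0)) (v (inord 1)) (v (inord 2)).
Proof.
by rewrite /quad3 /quad2 /= !expr2 !(mevalD, mevalM, mevalC, mevalXU).
Qed.

(** * Derivatives and degree bounds *)

Lemma mderivXU (n : nat) (R : comNzRingType) (i j : 'I_n) :
  ('X_j : {mpoly R[n]})^`M(i) = (j == i)%:R.
Proof.
rewrite mderivX mnm1E; case: eqP => [->|_]; last by rewrite scale0r.
rewrite scale1r (_ : (_ - _)%MM = 0%MM) ?mpolyX0 //.
by apply/mnmP=> k; rewrite mnmBE subnn mnm0E.
Qed.

Lemma msizeM_leq (n : nat) (R : idomainType) (d e : nat) (p q : {mpoly R[n]}) :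
  (msize p <= d.+1)%N -> (msize q <= e.+1)%N -> (msize (p * q) <= (d + e).+1)%N.
Proof.
have [->|p0] := eqVneq p 0; first by rewrite mul0r mmeasure0.
have [->|q0] := eqVneq q 0; first by rewrite mulr0 mmeasure0.
rewrite msizeM //; lia.
Qed.

Lemma msizeD_leq (n : nat) (R : nzRingType) (d : nat) (p q : {mpoly R[n]}) :
  (msize p <= d)%N -> (msize q <= d)%N -> (msize (p + q) <= d)%N.
Proof. by move=> hp hq; rewrite (leq_trans (mmeasureD_le _ _ _)) // geq_max hp. Qed.

(** The polynomial u; squaring the constant polynomial keeps [a%:MP] an atom for [ring]. *)
Definition circle_poly {R : realType} (a : R) : {mpoly R[3]} :=
  varx ^+ 2 + vary ^+ 2 - a%:MP ^+ 2.

Lemma torus_polyE (R : realType) (a : R) :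
  torus_poly a = circle_poly a ^+ 2 + varz ^+ 2 - 1.
Proof. by rewrite /torus_poly rmorphXn. Qed.

Lemma vf_act_torus (R : realType) (a : R) (chi : polyvf R) :
  vf_act chi (torus_poly a) =
    4 * circle_poly a * (varx * vfP chi + vary * vfQ chi) + 2 * varz * vfR chi.
Proof.
rewrite /vf_act torus_polyE /circle_poly !expr2 -(mpolyC1 3 R).
rewrite !(mderivB, mderivD, mderivM, mderivXU, mderivC) -!val_eqE /= !inordK //=.
ring.
Qed.

Lemma msize_circle_poly (R : realType) (a : R) : msize (circle_poly a) = 3%N.
Proof.
apply/eqP; rewrite eqn_leq; apply/andP; split.
  rewrite /circle_poly -rmorphXn /=.
  rewrite !msizeD_leq // ?mmeasureN ?mmeasureC ?mpolyXn ?msizeX ?mdegMn ?mdeg1 //.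
  by case: (_ == 0).
(* A smaller size would exclude x^2 from the support, but its coefficient is 1. *)
rewrite leqNgt; apply/negP => h.
have /msize_mdeg_ge : (msize (circle_poly a) <= mdeg (U_(inord 0) *+ 2 : 'X_{1..3}))%N.
  by rewrite mdegMn mdeg1.
rewrite mcoeff_msupp negbK /circle_poly -rmorphXn /= mcoeffB mcoeffD.
rewrite !mcoeffXn mcoeffC eqxx.
have -> : (U_(inord 1) *+ 2 == U_(inord 0) *+ 2 :> 'X_{1..3})%MM = false.
  apply/negbTE/eqP => /mnmP/(_ (inord 0)).
  by rewrite !mulmnE !mnm1E -!val_eqE /= !inordK.
rewrite -mdeg_eq0 mdegMn mdeg1 /= mulr0 subr0 addr0.
by rewrite oner_eq0.
Qed.

(** u^2 = F + (1 - z^2) has size 5 while 1 - z^2 has size at most 3. *)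
Lemma msize_torus_poly (R : realType) (a : R) : (5 <= msize (torus_poly a))%N.
Proof.
have u0 : circle_poly a != 0 by rewrite -msize_poly_eq0 msize_circle_poly.
have := mmeasureD_le mdeg (torus_poly a) (1 - varz ^+ 2).
have -> : torus_poly a + (1 - varz ^+ 2) = circle_poly a ^+ 2.
  by rewrite torus_polyE; ring.
rewrite expr2 msizeM // msize_circle_poly leq_max => /orP[//|].
have : (msize (1 - varz ^+ 2 : {mpoly R[3]}) <= 3)%N.
  by apply: msizeD_leq; rewrite ?mmeasureN ?msize1 // mpolyXn msizeX mdegMn mdeg1.
by move=> hz /leq_trans/(_ hz).
Qed.

Lemma torus_poly_neq0 (R : realType) (a : R) : torus_poly a != 0.
Proof. by rewrite -msize_poly_eq0 -lt0n (leq_trans _ (msize_torus_poly R a)). Qed.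

Lemma vf_deg_leq (R : realType) (chi : polyvf R) (d : nat) :
  (vf_deg chi <= d)%N =
    [&& (msize (vfP chi) <= d.+1)%N, (msize (vfQ chi) <= d.+1)%N
      & (msize (vfR chi) <= d.+1)%N].
Proof.
have predn_leq n : (n.-1 <= d)%N = (n <= d.+1)%N by case: n.
by rewrite /vf_deg /mpdeg !geq_max !predn_leq.
Qed.

Lemma mpdvd_linear (R : realType) (d : nat) (l p : {mpoly R[3]}) :
  msize l = 2%N -> (msize p <= d.+1)%N -> mpdvd l p ->
  exists2 q, (msize q <= d)%N & p = l * q.
Proof.
move=> hl hp [q def_p]; exists q => //.
have [->|q0] := eqVneq q 0; first by rewrite mmeasure0.
have l0 : l != 0 by rewrite -msize_poly_eq0 hl.
by move: hp; rewrite def_p msizeM // hl.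
Qed.

(** The image of F has degree at most 6 and F has degree at least 4; degrees add in a domain. *)
Lemma msize_cofactor (R : realType) (a : R) (chi : polyvf R) (K : {mpoly R[3]}) :
  (vf_deg chi <= 3)%N -> is_cofactor a chi K -> (msize K <= 3)%N.
Proof.
rewrite vf_deg_leq => /and3P[hP hQ hR]; rewrite /is_cofactor vf_act_torus => hK.
have [->|K0] := eqVneq K 0; first by rewrite mmeasure0.
have : (msize (K * torus_poly a) <= 7)%N.
  have C n : (msize (n%:R : {mpoly R[3]}) <= 1)%N.
    by rewrite -mpolyC_nat mmeasureC; case: (_ == 0).
  have X (i : 'I_3) : (msize ('X_i : {mpoly R[3]}) <= 2)%N by rewrite msizeX mdeg1.
  rewrite -hK; apply: msizeD_leq.
    apply: (msizeM_leq _ _ 2 4).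
      by apply: (msizeM_leq _ _ 0 2); rewrite ?msize_circle_poly.
    by apply: msizeD_leq; apply: (msizeM_leq _ _ 1 3) => //; apply: X.
  apply: (@leq_trans 5) => //; apply: (msizeM_leq _ _ 1 3) => //.
  by apply: (msizeM_leq _ _ 0 1); [apply: C|apply: X].
rewrite msizeM // ?torus_poly_neq0 //.
move: (mmeasure _ K) (mmeasure _ (torus_poly a)) (msize_torus_poly R a) => m n; lia.
Qed.

(** * The normal form and the equivalence *)

Lemma torus_form_cofactor (R : realType) (a c1 c2 : R) (chi : polyvf R) :
  torus_form a c1 c2 chi -> is_cofactor a chi (c2 *: varz ^+ 2).
Proof.
case=> hP hQ hR; rewrite /is_cofactor vf_act_torus hP hQ hR torus_polyE /circle_poly.
rewrite -!mul_mpolyC !(rmorphB, rmorphXn, rmorph1) /=.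
(* With q = 1/4 abstracted, the left side is a multiple of 4 q; multiplying the right side by 4 q =
   1 leaves an identity free of division. *)
have -> : c2 / 2 = 2 * (1 / 4) * c2 by lra.
have : 4 * (1 / 4) = 1 :> R by lra.
move: (1 / 4) => q q4; rewrite !rmorphM rmorph_nat.
have {}q4 : 4 * q%:MP = 1 :> {mpoly R[3]}.
  by rewrite -(mpolyC_nat 3 R 4) -rmorphM q4.
by rewrite -[RHS]mul1r -[X in _ = X * _]q4; ring.
Qed.

Lemma kolmogorov_cofactor_meval (R : realType) (a : R)
    (p q r K : {mpoly R[3]}) (v : 'I_3 -> R) :
  is_cofactor a (PolyVF (varx * p) (vary * q) (varz * r)) K ->
  let x := v (inord 0) in let y := v (inord 1) in let z := v (inord 2) in
  4 * (x ^+ 2 + y ^+ 2 - a ^+ 2) * (x ^+ 2 * p.@[v] + y ^+ 2 * q.@[v])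
    + 2 * z ^+ 2 * r.@[v]
  = K.@[v] * ((x ^+ 2 + y ^+ 2 - a ^+ 2) ^+ 2 + z ^+ 2 - 1).
Proof.
rewrite /is_cofactor vf_act_torus torus_polyE /circle_poly /= => /(congr1 (meval v)).
rewrite !expr2 -(mpolyC_nat 3 R 4) -(mpolyC_nat 3 R 2) -(mpolyC1 3 R).
by rewrite !(mevalN, mevalD, mevalM, mevalC, mevalXU) => E; lra.
Qed.

Theorem corollary4p1 (R : realType) (a : R) (ha : 1 < a) (chi : polyvf R)
    (hcubic : cubic chi) (hkol : kolmogorov chi) :
  (vf_on_torus a chi <-> exists c1 c2 : R, torus_form a c1 c2 chi) /\
  (forall c1 c2 : R, torus_form a c1 c2 chi ->
     forall K : {mpoly R[3]}, is_cofactor a chi K <-> K = c2 *: varz ^+ 2).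
Proof.
split; last first.
  move=> c1 c2 /torus_form_cofactor hform K; split=> [hK|-> //].
  (* The cofactor is unique because F is nonzero in a domain. *)
  by apply: (mulIf (torus_poly_neq0 R a)); rewrite -hK -hform.
split=> [[K hK]|[c1 [c2 /torus_form_cofactor hform]]]; last by exists (c2 *: varz ^+ 2).
have deg3 : (vf_deg chi <= 3)%N by rewrite hcubic.
have degK := msize_cofactor _ _ _ _ deg3 hK.
case: chi hK hkol deg3 {hcubic} => P Q S hK [/= dP dQ dS].
rewrite vf_deg_leq => /and3P[/= hP hQ hS].
have X i : msize ('X_i : {mpoly R[3]}) = 2%N by rewrite msizeX mdeg1.
have [p0 /msize3_quad3[p def_p] defP] := mpdvd_linear _ _ varx _ (X _) hP dP.
have [q0 /msize3_quad3[q def_q] defQ] := mpdvd_linear _ _ vary _ (X _) hQ dQ.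
have [r0 /msize3_quad3[r def_r] defS] := mpdvd_linear _ _ varz _ (X _) hS dS.
have [k defK] := msize3_quad3 _ _ degK.
rewrite defP defQ defS in hK *.
(* The conclusion is taken at the polynomial variables, the premise is checked by evaluation at real
   points. *)
have [x y z|eP eQ eR] :=
  quad3_torus R a p q r k ha _ {mpoly R[3]} (@mpolyC 3 R) varx vary varz.
  have := kolmogorov_cofactor_meval R a _ _ _ _
            (fun i : 'I_3 => nth 0 [:: x; y; z] i) hK.
  by rewrite /= def_p def_q def_r defK !quad3_meval !inordK.
have {}eP : p0 = (1 / 4)%:MP * ((k 9%N)%:MP * varz ^+ 2) + (p 5%N)%:MP * vary ^+ 2.
  exact: etrans def_p eP.
have {}eQ : q0 = (1 / 4)%:MP * ((k 9%N)%:MP * varz ^+ 2) - (p 5%N)%:MP * varx ^+ 2.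
  exact: etrans def_q eQ.
have {}eR : r0 = (k 9%N / 2)%:MP * (- (a%:MP ^+ 2 * (varx ^+ 2 + vary ^+ 2))
                                    + varz ^+ 2 + (a%:MP ^+ 4 - 1)).
  exact: etrans def_r eR.
exists (p 5%N), (k 9%N); split; rewrite /= ?eP ?eQ ?eR -!mul_mpolyC.
- by ring.
- by ring.
by rewrite rmorphB !rmorphXn rmorph1 /=; ring.
Qed.
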